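(* For every integer $n\ge1$ and every linear order on the vertex set of the Legendre polytope $P_n$, the pulling triangulation of the boundary of $P_n$ with respect to this order is a flag simplicial complex.
   Context: The Legendre polytope $P_n\subset\mathbb{R}^{n+1}$ is the convex hull of all $e_j-e_i$ with $i\ne j$ in $\{1,\ldots,n+1\}$ ($e_1,\ldots,e_{n+1}$ the standard basis); its boundary complex consists of all proper faces of $P_n$. Pulling triangulation (Hudson): for a polytopal complex $\mathcal{P}$ with a linear order $<$ on its vertex set, $\triangle(\mathcal{P})=\mathcal{P}$ if $\mathcal{P}$ is a single vertex; otherwise, with $v$ the least vertex, $\triangle(\mathcal{P})=\triangle(\mathcal{P}-v)\cup\bigcup_F\{\mathrm{conv}(\{v\}\cup G): G\in\triangle(\mathcal{P}(F))\}$, where $\mathcal{P}-v$ is the complex of faces not containing $v$, $\mathcal{P}(F)$ is the complex of faces contained in $F$, the union runs over the facets $F$ not containing $v$ of the maximal faces of $\mathcal{P}$ containing $v$, and the orders are restricted. This is a triangulation of $\mathcal{P}$ with no new vertices. A simplicial complex is flag if every minimal nonface has exactly two elements (equivalently, every set of vertices which are pairwise joined by edges is a face). *)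

(* Defs.v *)
From HB Require Import structures.
From mathcomp Require Import all_boot all_order all_algebra.
From mathcomp Require Import boolp classical_sets functions cardinality reals.

Set Implicit Arguments.
Unset Strict Implicit.
Unset Printing Implicit Defensive.

Import Order.TTheory GRing.Theory Num.Theory.

Local Open Scope classical_set_scope.
Local Open Scope ring_scope.

(* Points of R^d are row vectors; a polytope is a set of points; a complex is
   a set of polytopes.  The empty set is a face of every polytope, and it
   belongs to every complex. *)

Definition dot (R : realType) (d : nat) (c x : 'rV[R]_d) : R :=
  \sum_(k < d) c ord0 k * x ord0 k.

Definition conv (R : realType) (d : nat) (A : set 'rV[R]_d) : set 'rV[R]_d :=
  [set x | exists (m : nat) (p : 'I_m -> 'rV[R]_d) (w : 'I_m -> R),
     [/\ forall k, A (p k),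
         forall k, 0 <= w k,
         \sum_(k < m) w k = 1
       & x = \sum_(k < m) w k *: p k]].

(* Both Q itself (c = 0, b = 0) and the empty set (c = 0, b = 1) are faces
   of Q. *)
Definition face_of (R : realType) (d : nat) (Q F : set 'rV[R]_d) : Prop :=
  exists (c : 'rV[R]_d) (b : R),
    (forall x, Q x -> dot c x <= b) /\ F = Q `&` [set x | dot c x = b].

Definition facet_of (R : realType) (d : nat) (Q F : set 'rV[R]_d) : Prop :=
  [/\ face_of Q F, F <> Q
    & forall G, face_of Q G -> F `<=` G -> G = F \/ G = Q].

Definition vertices (R : realType) (d : nat) (Q : set 'rV[R]_d) :
    set 'rV[R]_d :=
  [set v | face_of Q [set v]].

Definition boundary_complex (R : realType) (d : nat) (Q : set 'rV[R]_d) :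
    set (set 'rV[R]_d) :=
  [set F | face_of Q F /\ F <> Q].

Definition complex_vertices (R : realType) (d : nat)
    (P : set (set 'rV[R]_d)) : set 'rV[R]_d :=
  [set v | P [set v]].

Definition maximal_face (R : realType) (d : nat)
    (P : set (set 'rV[R]_d)) (M : set 'rV[R]_d) : Prop :=
  P M /\ forall G, P G -> M `<=` G -> G = M.

(* P - v *)
Definition deletion (R : realType) (d : nat)
    (P : set (set 'rV[R]_d)) (v : 'rV[R]_d) : set (set 'rV[R]_d) :=
  [set F | P F /\ ~ F v].

(* P(F) *)
Definition restriction (R : realType) (d : nat)
    (P : set (set 'rV[R]_d)) (F : set 'rV[R]_d) : set (set 'rV[R]_d) :=
  [set G | P G /\ G `<=` F].

Definition strict_linear_order_on (T : Type) (V : set T)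
    (lt : T -> T -> Prop) : Prop :=
  [/\ forall x, V x -> ~ lt x x,
      forall x y z, V x -> V y -> V z -> lt x y -> lt y z -> lt x z
    & forall x y, V x -> V y -> x <> y -> lt x y \/ lt y x].

Definition least_vertex (R : realType) (d : nat)
    (lt : 'rV[R]_d -> 'rV[R]_d -> Prop) (P : set (set 'rV[R]_d))
    (v : 'rV[R]_d) : Prop :=
  complex_vertices P v /\
  forall u, complex_vertices P u -> u <> v -> lt v u.

Definition empty_or_vertex (R : realType) (d : nat)
    (P : set (set 'rV[R]_d)) : Prop :=
  P = [set set0] \/ exists v, P = [set set0; [set v]].

(* The set pulling lt P of polytopes is given by membership rules, one for each
   part of the recursive equation.  The recursion removes the least vertex, so
   on a finite complex these rules have only one solution.
   The case P = [set set0] is reached by the recursion: the only facet of a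
   one-point polytope [set v] is the empty face, and it gives the cone
   conv ([set v] `|` set0) = [set v] over an isolated vertex v. *)
Inductive pulling (R : realType) (d : nat)
    (lt : 'rV[R]_d -> 'rV[R]_d -> Prop) :
    set (set 'rV[R]_d) -> set (set 'rV[R]_d) :=
| pulling_base (P : set (set 'rV[R]_d)) (G : set 'rV[R]_d) :
    empty_or_vertex P -> P G -> pulling lt P G
| pulling_deletion (P : set (set 'rV[R]_d)) (v : 'rV[R]_d)
    (G : set 'rV[R]_d) :
    ~ empty_or_vertex P -> least_vertex lt P v ->
    pulling lt (deletion P v) G -> pulling lt P G
| pulling_cone (P : set (set 'rV[R]_d)) (v : 'rV[R]_d)
    (M F G : set 'rV[R]_d) :
    ~ empty_or_vertex P -> least_vertex lt P v ->
    maximal_face P M -> M v -> facet_of M F -> ~ F v ->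
    pulling lt (restriction P F) G -> pulling lt P (conv ([set v] `|` G)).

Definition affinely_independent (R : realType) (d m : nat)
    (p : 'I_m -> 'rV[R]_d) : Prop :=
  forall w : 'I_m -> R,
    \sum_(k < m) w k = 0 -> \sum_(k < m) w k *: p k = 0 ->
    forall k, w k = 0.

(* m = 0 gives the empty simplex. *)
Definition is_simplex (R : realType) (d : nat) (S : set 'rV[R]_d) : Prop :=
  exists (m : nat) (p : 'I_m -> 'rV[R]_d),
    affinely_independent p /\ S = conv (range p).

Definition geometric_simplicial_complex (R : realType) (d : nat)
    (T : set (set 'rV[R]_d)) : Prop :=
  [/\ finite_set T,
      T set0,
      forall S, T S -> is_simplex S,
      forall S F, T S -> face_of S F -> T F
    & forall S S', T S -> T S' ->
        face_of S (S `&` S') /\ face_of S' (S `&` S')].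

(* The abstract simplicial complex of the vertex sets of the cells of T. *)
Definition vertex_scheme (R : realType) (d : nat)
    (T : set (set 'rV[R]_d)) : set (set 'rV[R]_d) :=
  [set vertices S | S in T].

(* K is an abstract simplicial complex, given by its faces as sets of
   vertices; its vertices are the v such that [set v] is a face. *)
Definition minimal_nonface (V : Type) (K : set (set V)) (S : set V) : Prop :=
  [/\ S `<=` [set v | K [set v]],
      ~ K S
    & forall S', S' `<` S -> K S'].

Definition has_exactly_two_elements (V : Type) (S : set V) : Prop :=
  exists x y, x <> y /\ S = [set x; y].

Definition flag (V : Type) (K : set (set V)) : Prop :=
  forall S, minimal_nonface K S -> has_exactly_two_elements S.

Definition flag_simplicial_complex (R : realType) (d : nat)
    (T : set (set 'rV[R]_d)) : Prop :=
  geometric_simplicial_complex T /\ flag (vertex_scheme T).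

Definition legendre (R : realType) (n : nat) : set 'rV[R]_n.+1 :=
  conv [set x | exists i j : 'I_n.+1,
                  i != j /\ x = delta_mx ord0 j - delta_mx ord0 i].

(* Main.v *)
(* Faces of the boundary are the hulls of the blocks I x J (tails in I, heads
   in J, with I and J disjoint), so every complex met by the recursion consists
   of the blocks contained in some set X of arrows.  If v is the least element
   of X, then by compatibility of pairs a compatible set whose carrier (tails x
   heads) contains v contains v itself, and removing v leaves a set that misses
   the tail or the head of v, hence lies in a facet avoiding v.  By induction
   the cells of the triangulation are the hulls of the pairwise compatible
   sets, which gives flagness.

   These hulls form a simplicial complex because a vector has at most one
   representation with nonnegative coefficients supported on a compatible set:
   two representations have the same marginals, and at the least arrow v where
   they differ the smaller one has arrows a in the row and b in the column of v
   that are both larger than v, so v makes the pair a, b incompatible. *)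
Require Import Defs.
From mathcomp Require Import all_boot all_order all_algebra.
From mathcomp Require Import boolp classical_sets functions cardinality reals.
From mathcomp Require Import lra.

Set Implicit Arguments.
Unset Strict Implicit.
Unset Printing Implicit Defensive.

Import Order.TTheory GRing.Theory Num.Theory.

Local Open Scope classical_set_scope.
Local Open Scope ring_scope.

(** * Convex hulls of finite families *)

Section FiniteHull.
Variables (R : realType) (d : nat) (T : finType) (f : T -> 'rV[R]_d).
Implicit Types (s t : {set T}) (w u : T -> R) (c x : 'rV[R]_d) (b : R).

Definition hull s : set 'rV[R]_d := conv (f @` [set` s]).

(** Weights are functions on the whole index type, zero off [s], so that representations over
    different sets can be compared pointwise. *)
Lemma hullP s x : hull s x <-> exists w,
  [/\ forall a, 0 <= w a, forall a, a \notin s -> w a = 0,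
      \sum_a w a = 1 & x = \sum_a w a *: f a].
Proof.
split=> [[m [p [w [pA w0 w1 ->]]]]|[w [w0 ws w1 ->]]].
  have /choice[q qP] : forall k, exists a, a \in s /\ f a = p k.
    by move=> k; have [a sa fa] := pA k; exists a.
  exists (fun a => \sum_(k | q k == a) w k); split.
  - by move=> a; apply: sumr_ge0.
  - move=> a sa; rewrite big1 // => k /eqP qa.
    by move: sa; rewrite -qa; have [->] := qP k.
  - by rewrite -w1 [RHS](partition_big q predT).
  - under [RHS]eq_bigr => a _ do rewrite scaler_suml.
    rewrite [LHS](partition_big q predT) //=; apply: eq_bigr => a _.
    by apply: eq_bigr => k /eqP <-; have [_ ->] := qP k.
exists #|s|, (fun k => f (enum_val k)), (fun k => w (enum_val k)).
have sumE (V : nmodType) (F : T -> V) : (forall a, a \notin s -> F a = 0) ->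
    \sum_a F a = \sum_(k < #|s|) F (enum_val k).
  move=> Fs; rewrite -big_enum_val [RHS]big_mkcond /=; apply: eq_bigr => a _.
  by case: ifPn => // /Fs.
split=> [k|k||].
- by exists (enum_val k) => //=; apply: enum_valP.
- exact: w0.
- by rewrite -w1 [RHS]sumE.
- by rewrite [LHS]sumE // => a /ws ->; rewrite scale0r.
Qed.

Lemma mem_hull s a : a \in s -> hull s (f a).
Proof.
move=> sa; exists 1%N, (fun=> f a), (fun=> 1); split=> //.
- by rewrite big_ord1.
- by rewrite big_ord1 scale1r.
Qed.

Lemma conv_sub_hull (A : set 'rV[R]_d) s :
  A `<=` hull s -> conv A `<=` hull s.
Proof.
move=> sub x [m [p [w [pA w0 w1 ->]]]].
have /choice[u uP] := fun k => (hullP s (p k)).1 (sub _ (pA k)).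
apply/hullP; exists (fun a => \sum_k w k * u k a); split.
- by move=> a; apply: sumr_ge0 => k _; apply: mulr_ge0 => //; have [] := uP k.
- by move=> a sa; rewrite big1 // => k _; have [_ -> //] := uP k; rewrite mulr0.
- rewrite exchange_big /= -w1; apply: eq_bigr => k _.
  by rewrite -mulr_sumr; have [_ _ -> _] := uP k; rewrite mulr1.
- under [RHS]eq_bigr => a _ do rewrite scaler_suml.
  rewrite exchange_big /=; apply: eq_bigr => k _.
  have [_ _ _ ->] := uP k; rewrite scaler_sumr.
  by apply: eq_bigr => a _; rewrite scalerA.
Qed.

Lemma conv_subset (A B : set 'rV[R]_d) : A `<=` B -> conv A `<=` conv B.
Proof.
by move=> AB x [m [p [w [pA w0 w1 ->]]]]; exists m, p, w; split=> // k;
  apply: AB.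
Qed.

Lemma hull_subset s t : s \subset t -> hull s `<=` hull t.
Proof.
by move=> st; apply: conv_subset => _ [a /(fintype.subsetP st) ta <-]; exists a.
Qed.

Lemma conv_cone a s : conv ([set f a] `|` hull s) = hull (a |: s).
Proof.
apply/seteqP; split.
  apply: conv_sub_hull => x [->|]; first by apply: mem_hull; rewrite !inE eqxx.
  by apply: hull_subset; apply: finset.subsetUr.
apply: conv_subset => _ [y /= + <-]; rewrite !inE => /orP[/eqP ->|ys].
  by left.
by right; apply: mem_hull.
Qed.

Lemma hull_set0 : hull finset.set0 = set0.
Proof.
apply/seteqP; split=> // x /hullP[w [_ ws + _]].
by rewrite big1 => [/eqP|a _]; [rewrite eq_sym oner_eq0|apply: ws; rewrite inE].
Qed.

Lemma hull_set1 a : hull [set a]%SET = [set f a].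
Proof.
apply/seteqP; split=> [x /hullP[w [_ ws w1 ->]]|_ ->]; last first.
  by apply: mem_hull; rewrite inE.
have w0 a' : a' != a -> w a' = 0 by move=> aa'; apply: ws; rewrite inE.
move: w1; rewrite (bigD1 a) //= big1 // addr0 => w1.
rewrite (bigD1 a) //= w1 scale1r big1 ?addr0 // => a' /w0 ->.
by rewrite scale0r.
Qed.

Lemma dot_sum c w : dot c (\sum_a w a *: f a) = \sum_a w a * dot c (f a).
Proof.
rewrite /dot; under eq_bigr => k _ do rewrite summxE mulr_sumr.
rewrite exchange_big /=; apply: eq_bigr => a _; rewrite mulr_sumr.
by apply: eq_bigr => k _; rewrite mxE mulrCA.
Qed.

Lemma hull_dot_le c b s : (forall a, a \in s -> dot c (f a) <= b) ->
  forall x, hull s x -> dot c x <= b.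
Proof.
move=> sb x /hullP[w [w0 ws w1 ->]]; rewrite dot_sum -[b]mul1r -w1 mulr_suml.
apply: ler_sum => a _; have [sa|/ws ->] := boolP (a \in s).
  by rewrite ler_wpM2l // sb.
by rewrite !mul0r.
Qed.

(** The slack [b - dot c (f a)] is nonnegative on [s] and averages to zero at a point of the
    hyperplane, so every index with positive slack has weight zero. *)
Lemma hull_section c b s : (forall a, a \in s -> dot c (f a) <= b) ->
  hull s `&` [set x | dot c x = b] = hull [set a in s | dot c (f a) == b]%SET.
Proof.
move=> sb; apply/seteqP; split=> [x [/hullP[w [w0 ws w1 ->]]] /= eb|].
  apply/hullP; exists w; split=> // a; rewrite inE.
  have [sa /= nb|/ws //] := boolP (a \in s).
  have : \sum_a w a * (b - dot c (f a)) == 0.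
    under eq_bigr => ? _ do rewrite mulrBr.
    by rewrite sumrB -mulr_suml w1 mul1r -dot_sum eb subrr.
  rewrite psumr_eq0 => [/allP/(_ a)|a' _]; last first.
    have [sa'|/ws ->] := boolP (a' \in s); last by rewrite mul0r.
    by rewrite mulr_ge0 // subr_ge0 sb.
  rewrite mem_index_enum mulf_eq0 subr_eq0 [b == _]eq_sym (negPf nb) orbF.
  by move=> /(_ isT)/eqP.
move=> x /hullP[w [w0 ws w1 ->]]; split=> /=.
  apply/hullP; exists w; split=> // a sa; apply: ws.
  by rewrite inE (negPf sa).
rewrite dot_sum -[RHS]mul1r -w1 mulr_suml; apply: eq_bigr => a _.
have [|/ws ->] := boolP (a \in [set a in s | dot c (f a) == b]%SET).
  by rewrite inE => /andP[_ /eqP ->].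
by rewrite !mul0r.
Qed.

Lemma face_of_hullP s (F : set 'rV[R]_d) : face_of (hull s) F <->
  exists c b, (forall a, a \in s -> dot c (f a) <= b) /\
    F = hull [set a in s | dot c (f a) == b]%SET.
Proof.
split=> [[c [b [sb ->]]]|[c [b [sb ->]]]]; exists c, b.
  have sb' a : a \in s -> dot c (f a) <= b by move=> /mem_hull; apply: sb.
  by rewrite hull_section.
by rewrite hull_section //; split=> //; apply: hull_dot_le.
Qed.

End FiniteHull.

(** * Simplicial complexes from unique representations *)

Section SimplicialHulls.
Variables (R : realType) (d : nat) (T : finType) (f : T -> 'rV[R]_d).
Variable K : {set {set T}}.
Hypothesis K0 : finset.set0 \in K.
Hypothesis Ksub : forall s t : {set T}, s \subset t -> t \in K -> s \in K.
(** Uniqueness is asked for arbitrary nonnegative combinations, that is over cones, so it yields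
    linear and not merely affine independence. *)
Hypothesis Kuniq : forall (s t : {set T}) (w u : T -> R), s \in K -> t \in K ->
  (forall a, 0 <= w a) -> (forall a, a \notin s -> w a = 0) ->
  (forall a, 0 <= u a) -> (forall a, a \notin t -> u a = 0) ->
  \sum_a w a *: f a = \sum_a u a *: f a -> w =1 u.
Implicit Types s t : {set T}.

(** The positive and negative parts of [w] are two nonnegative representations of the same vector
    supported on [s], so they agree. *)
Lemma linearly_independent s (w : T -> R) : s \in K ->
  (forall a, a \notin s -> w a = 0) -> \sum_a w a *: f a = 0 -> w =1 fun=> 0.
Proof.
move=> sK ws w0 a.
have pE x : Num.max x 0 - Num.max (- x) 0 = x :> R.
  have [x0|x0] := lerP 0 x.
    by rewrite max_r ?oppr_le0 // subr0.
  by rewrite max_l ?oppr_ge0 ?ltW // opprK add0r.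
have /(_ a) : (fun a => Num.max (w a) 0) =1 (fun a => Num.max (- w a) 0).
  apply: (Kuniq sK sK) => [b|b /ws ->|b|b /ws ->|].
  - by rewrite le_max lexx orbT.
  - by rewrite maxxx.
  - by rewrite le_max lexx orbT.
  - by rewrite oppr0 maxxx.
  apply/eqP; rewrite -subr_eq0 -sumrB -[X in _ == X]w0; apply/eqP.
  by apply: eq_bigr => b _; rewrite -scalerBl pE.
by move=> e; rewrite -(pE (w a)) e subrr.
Qed.

Lemma linearly_independent_enum s (w : 'I_#|s| -> R) : s \in K ->
  \sum_k w k *: f (enum_val k) = 0 -> w =1 fun=> 0.
Proof.
move=> sK w0 k; pose u a := \sum_(k | enum_val k == a) w k.
have us a : a \notin s -> u a = 0.
  by move=> sa; rewrite /u big1 // => k' /eqP e; rewrite -e enum_valP in sa.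
have u0 : \sum_a u a *: f a = 0.
  rewrite -[RHS]w0 [RHS](partition_big (@enum_val _ (mem s)) predT) //=.
  apply: eq_bigr => a _; rewrite scaler_suml.
  by apply: eq_bigr => k' /eqP <-.
have := linearly_independent sK us u0 (enum_val k).
by rewrite /u (big_pred1 k) // => k'; rewrite (inj_eq enum_val_inj).
Qed.

(** The vectors indexed by [s] are independent, so their matrix has a right inverse and any values
    on them are attained. The values 0 on [t] and -1 on the rest of [s] expose [hull f t] as a
    face. *)
Lemma separating_functional s t : s \in K -> t \subset s ->
  exists c, forall a, a \in s -> dot c (f a) = - (a \notin t)%:R.
Proof.
move=> sK ts; pose A := \matrix_(k < #|s|) f (enum_val k).
have /row_freeP[B AB] : row_free A.
  apply: inj_row_free => v vA; apply/rowP => k; rewrite mxE.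
  apply: (linearly_independent_enum (w := v ord0)) => //.
  rewrite -[RHS]vA mulmx_sum_row; apply: eq_bigr => k' _.
  by rewrite rowK.
pose y := \col_(k < #|s|) (- (enum_val k \notin t)%:R : R).
exists (B *m y)^T => a sa.
have := congr1 (fun M => (M *m y) (enum_rank_in sa a) ord0) AB.
rewrite /= -mulmxA mul1mx !mxE enum_rankK_in // => <-.
by apply: eq_bigr => k _; rewrite !mxE enum_rankK_in // mulrC.
Qed.

Lemma face_of_hull_subset s t : s \in K -> t \subset s ->
  face_of (hull f s) (hull f t).
Proof.
move=> sK ts; have [c cE] := separating_functional sK ts.
apply/face_of_hullP; exists c, 0; split=> [a /cE ->|].
  by rewrite oppr_le0 ler0n.
congr (hull f _); apply/finset.setP => a; rewrite inE.
have [/cE ->|sa] := boolP (a \in s).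
  by rewrite oppr_eq0 pnatr_eq0; case: (a \in t).
by apply/negbTE; apply: contra sa; apply: fintype.subsetP.
Qed.

Lemma vertices_hull s : s \in K -> vertices (hull f s) = f @` [set` s].
Proof.
move=> sK; apply/seteqP; split=> [x /face_of_hullP[c [b [_ xE]]]|_ [a sa <-]].
  set r := finset _ in xE; have [r0|[a ra]] := set_0Vmem r.
    by have : [set x] x by []; rewrite xE r0 hull_set0.
  have : hull f r (f a) by apply: mem_hull.
  by rewrite -xE => /= fa; move: ra; rewrite inE => /andP[sa _]; exists a.
rewrite /vertices /= -hull_set1; apply: face_of_hull_subset => //.
by rewrite finset.sub1set.
Qed.

Lemma hull_setI s t : s \in K -> t \in K ->
  hull f s `&` hull f t = hull f (s :&: t)%SET.
Proof.
move=> sK tK; apply/seteqP; split=> [x [/hullP[w [w0 ws w1 ->]]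
  /hullP[u [u0 ut u1 wu]]]|x].
  have e := Kuniq sK tK w0 ws u0 ut wu.
  apply/hullP; exists w; split=> // a; rewrite inE negb_and => /orP[/ws //|/ut].
  by rewrite e.
by move=> h; split; move: x h; apply: hull_subset;
  [apply: finset.subsetIl|apply: finset.subsetIr].
Qed.

Lemma hull_simplicial_complex :
  geometric_simplicial_complex [set hull f s | s in [set` K]].
Proof.
split.
- by apply: finite_image; apply: finite_finset.
- by exists finset.set0 => //; apply: hull_set0.
- move=> _ [s sK <-].
  exists #|s|, (fun k => f (enum_val k)); split.
    by move=> w _; apply: linearly_independent_enum.
  congr conv; apply/seteqP; split=> [_ [a sa <-]|_ [k _ <-]].
    by exists (enum_rank_in sa a) => //; rewrite enum_rankK_in.
  by exists (enum_val k) => //=; apply: enum_valP.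
- move=> _ F [s sK <-] /face_of_hullP[c [b [_ ->]]].
  eexists; last by [].
  by apply: Ksub sK; apply/fintype.subsetP => a; rewrite inE => /andP[].
- move=> _ _ [s sK <-] [t tK <-]; rewrite hull_setI //.
  by split; apply: face_of_hull_subset => //;
    [apply: finset.subsetIl|apply: finset.subsetIr].
Qed.

End SimplicialHulls.

Definition arrow n := ('I_n.+1 * 'I_n.+1)%type.

(** * Faces of the Legendre polytope *)

Section Arrows.
Variables (R : realType) (n : nat).
Implicit Types (a : arrow n) (I J : {set 'I_n.+1}) (s X : {set arrow n}).

Definition arrow_vec a : 'rV[R]_n.+1 := delta_mx ord0 a.2 - delta_mx ord0 a.1.

Definition arrows : {set arrow n} := [set a | a.1 != a.2]%SET.

(** A product with [I] or [J] empty gives the empty polytope, so the empty face belongs to each of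
    these complexes. *)
Definition faces X : set (set 'rV[R]_n.+1) :=
  [set F | exists I J, [/\ [disjoint I & J]%B, finset.setX I J \subset X
                         & F = hull arrow_vec (finset.setX I J)]].

Lemma dot_arrow_vec c a : dot c (arrow_vec a) = c ord0 a.2 - c ord0 a.1.
Proof.
have deltaE k : \sum_(l < n.+1) c ord0 l * (l == k)%:R = c ord0 k.
  rewrite (bigD1 k) //= eqxx mulr1 big1 ?addr0 // => l /negPf ->.
  by rewrite mulr0.
rewrite -(deltaE a.1) -(deltaE a.2) -sumrB; apply: eq_bigr => k _.
by rewrite !mxE eqxx /= mulrBr.
Qed.

Lemma legendreE : @legendre R n = hull arrow_vec arrows.
Proof.
congr conv; apply/seteqP; split=> [_ [i [j [ij ->]]]|_ [[i j] /= + <-]].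
  by exists (i, j) => //=; rewrite inE.
by rewrite inE => ij; exists i, j.
Qed.

(** A functional that exposes a block: each endpoint of an arrow contributes at most 1, and for
    disjoint [I] and [J] the total 2 is reached exactly on arrows with tail in [I] and head in
    [J]. *)
Definition indicator I J : 'rV[R]_n.+1 :=
  \row_k ((k \in J)%:R - (k \in I)%:R).

Lemma dot_indicator_le I J a : dot (indicator I J) (arrow_vec a) <= 2.
Proof.
rewrite dot_arrow_vec !mxE.
by case: (a.2 \in J); case: (a.2 \in I); case: (a.1 \in J); case: (a.1 \in I);
  rewrite /=; lra.
Qed.

Lemma dot_indicator_eq I J a : [disjoint I & J]%B ->
  (dot (indicator I J) (arrow_vec a) == 2) = (a \in finset.setX I J).
Proof.
move=> IJ; have dis k : k \in I -> k \in J = false.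
  by move=> kI; apply: (disjointFr IJ).
case: a => i j; rewrite finset.in_setX dot_arrow_vec !mxE /=.
case: (boolP (i \in I)) (dis i) => [iI ->//|iI _];
  case: (boolP (j \in J)) (dis j) => [jJ jI|jJ _];
    try case: (boolP (j \in I)) jI => [_ /(_ isT)//|jI _] ;
  try case: (i \in J); try case: (j \in I); rewrite /=; apply/eqP; lra.
Qed.

Lemma face_of_hull_setX I J s : [disjoint I & J]%B ->
  finset.setX I J \subset s ->
  face_of (hull arrow_vec s) (hull arrow_vec (finset.setX I J)).
Proof.
move=> IJ IJs; apply/face_of_hullP; exists (indicator I J), 2; split=> [a _|].
  exact: dot_indicator_le.
congr hull; apply/finset.setP => a; rewrite [RHS]inE dot_indicator_eq //.
by have [/(fintype.subsetP IJs) ->|_] := boolP (a \in finset.setX I J);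
  rewrite ?andbF.
Qed.

Lemma setX1 a : finset.setX [set a.1] [set a.2] = [set a]%SET.
Proof. by apply/finset.setP => b; rewrite !inE -pair_eqE. Qed.

Lemma arrow_disjoint a : a \in arrows -> [disjoint [set a.1]%SET &
  [set a.2]%SET]%B.
Proof.
by rewrite inE => a12; rewrite finset.disjoints_subset finset.sub1set !inE.
Qed.

(** The indicator of the endpoints of [a] attains 2 at [a] alone, so the section of the hull at
    level 2 is empty unless [a \in s]. Inclusions of hulls thus become inclusions of sets of
    arrows. *)
Lemma arrow_vec_in_hull s a : a \in arrows ->
  hull arrow_vec s (arrow_vec a) -> a \in s.
Proof.
move=> aA sa; have dis := arrow_disjoint aA.
have : (hull arrow_vec s `&` [set x | dot (indicator [set a.1] [set a.2]) x =
  2])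
    (arrow_vec a).
  by split=> //=; apply/eqP; rewrite dot_indicator_eq // setX1 inE.
rewrite hull_section => [|b _]; last exact: dot_indicator_le.
set r := finset _; have [r0|[b]] := set_0Vmem r; first by rewrite r0 hull_set0.
by rewrite inE dot_indicator_eq // setX1 inE => /andP[? /eqP <-].
Qed.

Lemma arrow_vec_inj : {in arrows &, injective arrow_vec}.
Proof.
move=> a b aA bA ab; apply/eqP; rewrite -finset.in_set1;
  apply: arrow_vec_in_hull => //.
by rewrite ab; apply: mem_hull; rewrite inE.
Qed.

Lemma vertices_legendre a : a \in arrows ->
  vertices (@legendre R n) (arrow_vec a).
Proof.
move=> aA; rewrite legendreE /vertices /= -hull_set1 -setX1.
by apply: face_of_hull_setX; rewrite ?arrow_disjoint // setX1 finset.sub1set.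
Qed.

Lemma boundary_legendre : (0 < n)%N ->
  boundary_complex (@legendre R n) = faces arrows.
Proof.
move=> n0; rewrite legendreE; apply/seteqP;
  split=> [F [/face_of_hullP[c [b [cb FE]]] Fn]|].
  rewrite FE; set s := finset _ in FE *.
  have cbE i j : i != j -> c ord0 j - c ord0 i <= b.
    by move=> ij; rewrite -(dot_arrow_vec c (i, j)) cb // inE.
  have sE i j : ((i, j) \in s) = (i != j) && (c ord0 j - c ord0 i == b).
    by rewrite !inE dot_arrow_vec.
  (* A bound [b > 0] exposes a block, while [b <= 0] exposes either nothing or the whole
     polytope. *)
  have [b0|b0] := ltrP 0 b.
    exists [set i | [exists j, (i, j) \in s]]%SET, [set j |
      [exists i, (i, j) \in s]]%SET.
    (* The values on [(i, j)] and [(i', j')] add up to [2b] and each is at most [b], so both equal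
       [b]. If one of these pairs had equal entries, its value 0 would force the other value to be
       [2b], which is impossible as [b > 0]. *)
    have key i j' i' j : (i, j') \in s -> (i', j) \in s -> (i != j) &&
      ((i, j) \in s).
      rewrite !sE => /andP[ij' /eqP e1] /andP[i'j /eqP e2].
      have ij : i != j.
        apply: contraTneq b0 => ij; subst j; rewrite -leNgt.
        have [e|/cbE] := eqVneq i' j'; last by lra.
        by rewrite e in e2; lra.
      rewrite ij /=; apply/eqP; have := cbE _ _ ij.
      have [e|/cbE] := eqVneq i' j'; last by lra.
      by rewrite e in e2; lra.
    have sXE : finset.setX [set i | [exists j, (i, j) \in s]]%SET
        [set j | [exists i, (i, j) \in s]]%SET = s.
      apply/finset.setP => -[i j]; rewrite finset.in_setX.
      apply/andP/idP => [[]|h]; last by split; rewrite inE; apply/existsP;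
        [exists j|exists i].
      rewrite inE => /existsP[j' h1]; rewrite inE => /existsP[i' h2].
      by have /andP[] := key _ _ _ _ h1 h2.
    split; rewrite ?sXE //.
      rewrite finset.disjoints_subset; apply/fintype.subsetP => i.
      rewrite !inE => /existsP[j' h1]; apply/existsP => -[i' h2].
      by have := key _ _ _ _ h1 h2; rewrite eqxx.
    by apply/fintype.subsetP => -[i j]; rewrite sE inE => /andP[].
  have [s0|[[i j]]] := set_0Vmem s.
    exists finset.set0, finset.set0; rewrite s0; split.
    - by rewrite -finset.setI_eq0 finset.set0I.
    - by apply/fintype.subsetP => -[i j]; rewrite !inE.
    - by congr hull; apply/finset.setP => -[i j]; rewrite !inE.
  (* Equality at [(i, j)] and the bound at [(j, i)] give [b = 0]; the bounds at an arrow and its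
     reverse then make [c] constant, so the section is the whole polytope. *)
  rewrite sE => /andP[ij /eqP e1]; case: Fn; rewrite FE; congr hull.
  apply/finset.setP => -[k l]; rewrite sE inE /=; case: eqVneq => //= kl.
  have lk : l != k by rewrite eq_sym.
  have ji : j != i by rewrite eq_sym.
  by apply/eqP; have := cbE _ _ kl; have := cbE _ _ lk; have := cbE _ _ ji; lra.
move=> _ [I [J [IJ sub ->]]]; split; first exact: face_of_hull_setX.
(* A block with all the arrows would contain an arrow and its reverse, making a node both tail and
   head. Two distinct nodes exist because [0 < n]. *)
move=> e; have all a : a \in arrows -> a \in finset.setX I J.
  by move=> aA; apply: arrow_vec_in_hull => //; rewrite e; apply: mem_hull.
have o1 : ord0 != ord_max :> 'I_n.+1 by rewrite -val_eqE /= eq_sym -lt0n.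
have := all (ord0, ord_max); have := all (ord_max, ord0).
rewrite !inE /= eq_sym o1 => /(_ isT)/andP[_ h] /(_ isT)/andP[h' _].
by move: IJ; rewrite -finset.setI_eq0 => /eqP/finset.setP/(_ ord0);
  rewrite !inE h h'.
Qed.

Lemma complex_vertices_faces X x : X \subset arrows ->
  complex_vertices (faces X) x <-> exists2 a, a \in X & x = arrow_vec a.
Proof.
move=> XA; split=> [[I [J [IJ sub e]]]|[a aX ->]].
  have [s0|[a aIJ]] := set_0Vmem (finset.setX I J).
    by have : [set x] x by []; rewrite e s0 hull_set0.
  exists a; first exact: fintype.subsetP aIJ.
  by have := mem_hull arrow_vec aIJ; rewrite -e.
exists [set a.1]%SET, [set a.2]%SET; rewrite setX1 hull_set1 finset.sub1set.
by split=> //; apply: arrow_disjoint; apply: fintype.subsetP aX.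
Qed.

(** Together with [restriction_faces], this keeps the recursion within complexes of the form
    [faces X], each time replacing [X] by a subset. *)
Lemma deletion_faces X a : a \in arrows ->
  deletion (faces X) (arrow_vec a) = faces (X :\ a).
Proof.
move=> aA; apply/seteqP; split=> [F [[I [J [IJ sub FE]]] aIJ]|F [I [J [IJ]]]].
  subst F.
  exists I, J; split=> //; apply/fintype.subsetP => b bIJ.
  rewrite in_setD1 (fintype.subsetP sub) // andbT.
  by apply: contra_notN aIJ => /eqP <-; apply: mem_hull.
rewrite finset.subsetD1 => /andP[sub aIJ] ->; split; first by exists I, J.
by move=> /(arrow_vec_in_hull aA); apply/negP.
Qed.

Lemma restriction_faces X s : X \subset arrows ->
  restriction (faces X) (hull arrow_vec s) = faces (X :&: s).
Proof.
move=> XA; apply/seteqP; split=> [F [[I [J [IJ sub FE]]] IJs]|F [I [J [IJ]]]].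
  subst F.
  exists I, J; split=> //; rewrite finset.subsetI sub /=.
  apply/fintype.subsetP => a aIJ; apply: arrow_vec_in_hull.
    by apply: (fintype.subsetP XA); apply: fintype.subsetP aIJ.
  by apply: IJs; apply: mem_hull.
rewrite finset.subsetI => /andP[sub IJs] ->; split; first by exists I, J.
exact: hull_subset.
Qed.

End Arrows.

(** * Compatible sets of arrows *)

Section Compatible.
Variables (n : nat) (prec : rel (arrow n)).
Implicit Types (a b : arrow n) (I J : {set 'I_n.+1}) (s t X : {set arrow n}).
Hypothesis prec_irr : {in arrows n, forall a, ~~ prec a a}.
Hypothesis prec_trans : {in arrows n & &, transitive prec}.
Hypothesis prec_total :
  {in arrows n &, forall a b, a != b -> prec a b || prec b a}.

(** An element with the fewest predecessors in [X] is least, since anything before it would have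
    strictly fewer. *)
Lemma exists_min X : X \subset arrows n -> X != finset.set0 ->
  exists2 v, v \in X & forall a, a \in X -> a != v -> prec v a.
Proof.
move=> /fintype.subsetP XA /set0Pn[a0 a0X].
pose below a := [set b in X | prec b a]%SET.
case: (arg_minnP (fun a => #|below a|) a0X) => v vX vmin;
  exists v => // a aX av.
have /orP[av'|//] := prec_total (XA _ aX) (XA _ vX) av.
have := vmin _ aX; rewrite leqNgt => /negP[]; apply: proper_card.
apply/properP; split.
  apply/fintype.subsetP => b; rewrite !inE => /andP[bX ba].
  by rewrite bX (prec_trans (XA _ aX)) ?XA.
by exists a; rewrite !inE aX //= prec_irr ?XA.
Qed.

(* For [a.1 != b.1] and [a.2 != b.2], the last two conditions say that the
   least vertex of the square spanned by [a] and [b] is [a] or [b], so that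
   pulling subdivides the square along the diagonal [ab]. *)
Definition compat a b :=
  [&& a.1 != b.2, b.1 != a.2, ~~ (prec (a.1, b.2) a && prec (a.1, b.2) b)
    & ~~ (prec (b.1, a.2) a && prec (b.1, a.2) b)].

Definition compatible_sets : {set {set arrow n}} :=
  [set s : {set arrow n} | [forall a in s, forall b in s, compat a b]]%SET.

Definition carrier s :=
  finset.setX [set a.1 | a in s]%SET [set a.2 | a in s]%SET.

Lemma compatible_setsP s :
  reflect (forall a b, a \in s -> b \in s ->
    compat a b) (s \in compatible_sets).
Proof.
rewrite inE; apply: (iffP forall_inP) => h a; first by move=> b /h/forall_inP;
  apply.
by move=> aS; apply/forall_inP => b; apply: h.
Qed.

Lemma compatC a b : compat a b = compat b a.
Proof.
rewrite /compat; case: (a.1 == b.2); case: (b.1 == a.2) => //=.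
by rewrite [in RHS]andbC; congr (~~ _ && ~~ _); apply: andbC.
Qed.

Lemma compatible_subset s t :
  s \subset t -> t \in compatible_sets -> s \in compatible_sets.
Proof.
move=> /fintype.subsetP st /compatible_setsP tK;
  apply/compatible_setsP => a b aS bS.
by apply: tK; apply: st.
Qed.

Lemma compatible_set0 : finset.set0 \in compatible_sets.
Proof. by apply/compatible_setsP => a b; rewrite inE. Qed.

Lemma carrierP s v :
  reflect (exists a b, [/\ a \in s, b \in s & v =
    (a.1, b.2)]) (v \in carrier s).
Proof.
case: v => i j; rewrite finset.in_setX.
apply: (iffP andP) => [[/imsetP[a aS ->] /imsetP[b bS ->]]|[a [b [aS bS [->
  ->]]]]].
  by exists a, b.
by split; apply: imset_f.
Qed.

Lemma subset_carrier s : s \subset carrier s.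
Proof.
by apply/fintype.subsetP => a aS; apply/carrierP; exists a, a; split=> //;
  case: a aS.
Qed.

Lemma carrier_subset s I J :
  s \subset finset.setX I J -> carrier s \subset finset.setX I J.
Proof.
move=> /fintype.subsetP sub; apply/fintype.subsetP =>
  _ /carrierP[a [b [/sub aS /sub bS ->]]].
by move: aS bS; case: a => ? ?; case: b => ? ?;
  rewrite !finset.in_setX => /andP[-> _] /andP[].
Qed.

Lemma carrierS s t : s \subset t -> carrier s \subset carrier t.
Proof.
by move=> st; apply: carrier_subset;
  apply: fintype.subset_trans (subset_carrier t).
Qed.

Lemma carrier_disjoint s : s \in compatible_sets ->
  [disjoint [set a.1 | a in s]%SET & [set a.2 | a in s]%SET]%B.
Proof.
move=> /compatible_setsP sK; rewrite finset.disjoints_subset.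
apply/fintype.subsetP => _ /imsetP[a aS ->]; rewrite inE.
by apply/imsetP => -[b bS ab]; have /and4P[/eqP] := sK _ _ aS bS.
Qed.

Lemma setX_arrows I J : [disjoint I & J]%B -> finset.setX I J \subset arrows n.
Proof.
move=> IJ; apply/fintype.subsetP => -[i j];
  rewrite finset.in_setX inE /= => /andP[iI jJ].
by apply: contraTneq jJ => <-; rewrite (disjointFr IJ).
Qed.

Lemma carrier_arrows s : s \in compatible_sets -> carrier s \subset arrows n.
Proof. by move=> sK; apply: setX_arrows; apply: carrier_disjoint. Qed.

Lemma compatible_arrows s : s \in compatible_sets -> s \subset arrows n.
Proof.
by move=> sK; apply: fintype.subset_trans (carrier_arrows sK);
  apply: subset_carrier.
Qed.

Lemma compatible_cross s a b : s \in compatible_sets -> a \in s -> b \in s ->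
  prec (a.1, b.2) a -> prec (a.1, b.2) b -> False.
Proof.
by move=> /compatible_setsP sK aS bS pa pb; have /and4P[_ _] := sK _ _ aS bS;
  rewrite pa pb.
Qed.

(** Write [v = (a.1, b.2)] with [a] and [b] in [s]. If neither is [v], both come after [v], and the
    corner [v] makes them incompatible. *)
Lemma min_in_carrier s X v : (forall a, a \in X -> a != v -> prec v a) ->
  s \in compatible_sets -> carrier s \subset X -> v \in carrier s -> v \in s.
Proof.
move=> vmin sK /fintype.subsetP sX /carrierP[a [b [aS bS vE]]].
have sX' c : c \in s -> c \in X by move=> cS;
  apply/sX/(fintype.subsetP (subset_carrier s)).
have [<- //|av] := eqVneq a v; have [<- //|bv] := eqVneq b v.
have pa := vmin _ (sX' _ aS) av; have pb := vmin _ (sX' _ bS) bv.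
by case: (compatible_cross sK aS bS); rewrite -vE.
Qed.

Lemma compatible_set1 a : a \in arrows n -> [set a]%SET \in compatible_sets.
Proof.
move=> aA; apply/compatible_setsP => b c; rewrite !inE => /eqP -> /eqP ->.
have := prec_irr aA; move: aA; case: a => i j;
  rewrite inE /compat /= => -> /negPf ->.
by [].
Qed.

(** This is the cone step. No arrow of the block precedes [v], while each corner condition between
    [v] and an arrow of the block forbids a conjunction that contains some [prec _ v]. *)
Lemma compatible_setU1 v s I J X : (forall a, a \in X -> a != v -> prec v a) ->
  [disjoint I & J]%B -> finset.setX I J \subset X -> X \subset arrows n ->
  v \in finset.setX I J -> s \subset finset.setX I J -> s \in compatible_sets ->
  v |: s \in compatible_sets.
Proof.
move=> vmin IJ /fintype.subsetP IJX /fintype.subsetP XA vIJ /fintype.subsetP sIJ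
  sK.
have nprec a : a \in X -> ~~ prec a v.
  move=> aX; have [->|av] := eqVneq a v; first by rewrite prec_irr // XA // IJX.
  apply/negP => pav; have vA := XA _ (IJX _ vIJ).
  by have := prec_irr vA; rewrite (prec_trans (XA _ aX) vA vA (vmin _ aX av)
    pav).
have vs b : b \in finset.setX I J -> compat v b.
  move=> bIJ; rewrite /compat; have := nprec (v.1, b.2);
    have := nprec (b.1, v.2).
  move: vIJ bIJ; case: (v) => i j; case: b => k l.
  rewrite !finset.in_setX /= => /andP[iI jJ] /andP[kI lJ].
  rewrite !IJX ?finset.in_setX ?kI ?jJ ?iI ?lJ // => /(_ isT)/negPf ->
    /(_ isT)/negPf ->.
  rewrite /= !andbT; apply/andP.
  by split; [apply: contraTneq lJ|apply: contraTneq jJ] => <-;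
    rewrite (disjointFr IJ).
apply/compatible_setsP => a b;
  rewrite !inE => /orP[/eqP ->|aS] /orP[/eqP ->|bS].
- exact: vs.
- by apply/vs/sIJ.
- by rewrite compatC; apply/vs/sIJ.
- by move/compatible_setsP: sK; apply.
Qed.

End Compatible.

(** * Uniqueness of representations *)

Section Uniqueness.
Variables (R : realType) (n : nat) (prec : rel (arrow n)).
Hypothesis prec_irr : {in arrows n, forall a, ~~ prec a a}.
Hypothesis prec_trans : {in arrows n & &, transitive prec}.
Hypothesis prec_total :
  {in arrows n &, forall a b, a != b -> prec a b || prec b a}.
Local Notation K := (compatible_sets prec).
Local Notation vec := (@arrow_vec R n).
Implicit Types (s t : {set arrow n}) (w u : arrow n -> R).

Lemma coord_sum_arrow_vec w k : (\sum_a w a *: vec a) ord0 k =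
  \sum_(a | a.2 == k) w a - \sum_(a | a.1 == k) w a.
Proof.
rewrite summxE [\sum_(a | a.2 == k) _]big_mkcond [\sum_(a | a.1 ==
  k) _]big_mkcond.
rewrite -sumrB; apply: eq_bigr => a _; rewrite !mxE eqxx /= ![k == _]eq_sym.
by case: (a.2 == k); case: (a.1 == k); rewrite mulrBr ?mulr1 ?mulr0.
Qed.

Lemma tail_or_head_sum0 s w k : s \in K -> (forall a, a \notin s -> w a = 0) ->
  \sum_(a | a.2 == k) w a = 0 \/ \sum_(a | a.1 == k) w a = 0.
Proof.
move=> /compatible_setsP sK ws.
have [/exists_inP[a aS /eqP ak]|none] := boolP [exists a in s, a.2 == k].
  right; rewrite big1 // => b /eqP bk; apply: ws; apply/negP => bS.
  by have /and4P[_] := sK _ _ aS bS; rewrite ak bk eqxx.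
left; rewrite big1 // => b bk; apply: ws; apply: contra none => bS.
by apply/exists_inP; exists b.
Qed.

(* No node is both a tail and a head, so the coordinates of the vector
   determine the mass leaving and the mass entering each node. *)
Lemma marginals_eq s t w u : s \in K -> t \in K ->
  (forall a, 0 <= w a) -> (forall a, a \notin s -> w a = 0) ->
  (forall a, 0 <= u a) -> (forall a, a \notin t -> u a = 0) ->
  \sum_a w a *: vec a = \sum_a u a *: vec a ->
  forall k, \sum_(a | a.1 == k) w a = \sum_(a | a.1 == k) u a /\
            \sum_(a | a.2 == k) w a = \sum_(a | a.2 == k) u a.
Proof.
move=> sK tK w0 ws u0 ut e k.
have := congr1 (fun x : 'rV_n.+1 => x ord0 k) e;
  rewrite /= !coord_sum_arrow_vec.
have ge0 (P : pred (arrow n)) v : (forall a, 0 <= v a :> R) -> 0 <= \sum_(a |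
  P a) v a.
  by move=> v0; apply: sumr_ge0.
have := ge0 (fun a => a.1 == k) _ w0; have := ge0 (fun a => a.2 == k) _ w0.
have := ge0 (fun a => a.1 == k) _ u0; have := ge0 (fun a => a.2 == k) _ u0.
(* In the mixed cases the inflow under one weight equals minus the outflow under the other; both are
   nonnegative, hence zero. *)
by case: (tail_or_head_sum0 k sK ws) => ->;
  case: (tail_or_head_sum0 k tK ut) => ->;
  split; lra.
Qed.

Lemma sum_eq_exists_lt (P : pred (arrow n)) w u v :
  \sum_(a | P a) w a = \sum_(a | P a) u a -> P v -> u v < w v ->
  exists2 a, P a & w a < u a.
Proof.
move=> e Pv uw; have [/exists_inP[a Pa wu]|none] :=
  boolP [exists a in P, w a < u a].
  by exists a.
have: \sum_(a | P a) u a < \sum_(a | P a) w a.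
  rewrite (bigD1 v) //= [X in _ < X](bigD1 v) //=; apply: ltr_leD => //.
  apply: ler_sum => a /andP[Pa _]; rewrite leNgt; apply: contra none => h.
  by apply/exists_inP; exists a.
by rewrite e ltxx.
Qed.

Lemma not_lt_at_min t w u v : t \in K ->
  (forall a, a \notin t -> u a = 0) -> (forall a, 0 <= w a) ->
  (forall k, \sum_(a | a.1 == k) w a = \sum_(a | a.1 == k) u a /\
             \sum_(a | a.2 == k) w a = \sum_(a | a.2 == k) u a) ->
  (forall a, w a != u a -> a != v -> prec v a) -> ~ u v < w v.
Proof.
move=> tK ut w0 marg vmin uw.
have [a /eqP a1 wa] := sum_eq_exists_lt (marg v.1).1 (eqxx _) uw.
have [b /eqP b2 wb] := sum_eq_exists_lt (marg v.2).2 (eqxx _) uw.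
(* Here [u c] exceeds a nonnegative number, so [c] lies in [t]; at [v] the inequality goes the other
   way, so [c] differs from [v]. *)
have key c : w c < u c -> c \in t /\ prec v c.
  move=> wc; split; last first.
    apply: vmin; first by rewrite lt_eqF.
    by apply: contraTneq wc => ->; rewrite -leNgt ltW.
  by apply: contraTT wc => /ut ->; rewrite -leNgt.
have [[at_ pa] [bt pb]] := (key _ wa, key _ wb).
by apply: (compatible_cross tK at_ bt); rewrite a1 b2 -surjective_pairing.
Qed.

Lemma representation_unique s t w u : s \in K -> t \in K ->
  (forall a, 0 <= w a) -> (forall a, a \notin s -> w a = 0) ->
  (forall a, 0 <= u a) -> (forall a, a \notin t -> u a = 0) ->
  \sum_a w a *: vec a = \sum_a u a *: vec a -> w =1 u.
Proof.
move=> sK tK w0 ws u0 ut e; have marg := marginals_eq sK tK w0 ws u0 ut e.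
pose D := [set a | w a != u a]%SET.
(* Compatible sets contain only arrows, so both weights vanish elsewhere. A nonempty [D] therefore
   has a least element for [prec]. *)
have DA : D \subset arrows n.
  apply/fintype.subsetP => a; rewrite [a \in D]inE; apply: contraR => aA.
  have aN r : r \in K -> a \notin r.
    by move=> /compatible_arrows/fintype.subsetP rA; apply: contra aA;
      apply: rA.
  by rewrite ws ?ut ?aN.
have [D0 a|/(exists_min prec_irr prec_trans prec_total DA)[v vD vmin]] :=
  eqVneq D finset.set0.
  by have /finset.setP/(_ a) := D0; rewrite !inE => /negbFE/eqP.
have vmin' a : w a != u a -> a != v -> prec v a by move=> h; apply: vmin;
  rewrite inE.
move: vD; rewrite inE neq_lt => /orP[wu|uw]; exfalso.
  apply: (not_lt_at_min sK ws u0 _ _ wu) => [k|a]; last by rewrite eq_sym;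
    apply: vmin'.
  by have [-> ->] := marg k.
exact: (not_lt_at_min tK ut w0 marg vmin' uw).
Qed.

End Uniqueness.

(** * Facets of blocks *)

Section Facets.
Variables (R : realType) (n : nat).
Local Notation vec := (@arrow_vec R n).
Implicit Types (a v : arrow n) (I J : {set 'I_n.+1}) (s t X : {set arrow n}).

(** The last premise expresses that [t] and any one further arrow of [s] affinely span [s]; a face
    containing [hull vec t] and one more arrow is then all of [hull vec s]. *)
Lemma facet_of_criterion s t v : s \subset arrows n -> t \subset s ->
  v \in s -> v \notin t -> face_of (hull vec s) (hull vec t) ->
  (forall c b a, (forall a', a' \in t -> dot c (vec a') = b) ->
     a \in s -> a \notin t -> dot c (vec a) = b ->
     forall a', a' \in s -> dot c (vec a') = b) ->
  facet_of (hull vec s) (hull vec t).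
Proof.
move=> /fintype.subsetP sA /fintype.subsetP ts vs vt face crit; split=> //.
  move=> e; case/negP: vt; apply: (@arrow_vec_in_hull R _ _ _ (sA _ vs)).
  by rewrite e; apply: mem_hull.
move=> _ /face_of_hullP[c [b [_ ->]]]; set r := finset _ => tr.
have rE a : (a \in r) = (a \in s) && (dot c (vec a) == b) by rewrite inE.
have tr' a : a \in t -> a \in r.
  by move=> at_; apply: (@arrow_vec_in_hull R _ _ _ (sA _ (ts _ at_)));
    apply/tr/mem_hull.
have tb a : a \in t -> dot c (vec a) = b by move=> /tr';
  rewrite rE => /andP[_ /eqP].
have [/fintype.subsetP rt|/subsetPn[a ar at_]] := boolP (r \subset t).
  by left; congr hull; apply/finset.setP => a; apply/idP/idP => [/rt|/tr'].
right; congr hull; apply/finset.setP => a'; rewrite rE.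
have [as_ /=|//] := boolP (a' \in s); apply/eqP.
by move: ar; rewrite rE => /andP[aS /eqP ab]; apply: (crit c b a).
Qed.

(** A remaining tail [i1] forces [c] to be constant on [J], so one arrow of the block leaving [v.1]
    determines the value on all of them; if [J] is a singleton there is only one. Removing the only
    tail when there are several heads would leave the empty face, which is not a facet. *)
Lemma facet_remove_tail I J v : [disjoint I & J]%B -> v \in finset.setX I J ->
  (I :\ v.1 != finset.set0) || (J == [set v.2]%SET) ->
  facet_of (hull vec (finset.setX I J)) (hull vec (finset.setX (I :\ v.1) J)).
Proof.
move=> IJ; case: v => i0 j0; rewrite finset.in_setX => /andP[/= iI jJ] cond.
have sub : finset.setX (I :\ i0) J \subset finset.setX I J.
  by apply: finset.setXS => //; apply: finset.subD1set.
apply: (@facet_of_criterion _ _ (i0, j0)) => //.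
- exact: setX_arrows.
- by rewrite finset.in_setX iI.
- by rewrite finset.in_setX !inE eqxx.
- apply: face_of_hull_setX => //.
  by apply: disjointWl IJ; apply: finset.subD1set.
move=> c b [i j] tb; rewrite !finset.in_setX /= => /andP[iI' jJ'].
rewrite in_setD1 iI' jJ' !andbT negbK => /eqP ii0; subst i0 => ab [k l].
rewrite finset.in_setX /= => /andP[kI lJ].
have [kj|ki] := eqVneq k i; last first.
  by apply: tb; rewrite finset.in_setX in_setD1 /= ki kI lJ.
subst k; case/orP: cond => [/set0Pn[i1]|/eqP J1]; last first.
  by move: lJ jJ'; rewrite J1 !inE => /eqP -> /eqP <-.
rewrite in_setD1 => /andP[i1i i1I].
have h l' : l' \in J -> dot c (vec (i1, l')) = b.
  by move=> lJ'; apply: tb; rewrite finset.in_setX in_setD1 /= i1i i1I lJ'.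
by have := h _ lJ; have := h _ jJ'; move: ab; rewrite !dot_arrow_vec /=; lra.
Qed.

Lemma facet_remove_head I J v : [disjoint I & J]%B -> v \in finset.setX I J ->
  (J :\ v.2 != finset.set0) || (I == [set v.1]%SET) ->
  facet_of (hull vec (finset.setX I J)) (hull vec (finset.setX I (J :\ v.2))).
Proof.
move=> IJ; case: v => i0 j0; rewrite finset.in_setX => /andP[/= iI jJ] cond.
have sub : finset.setX I (J :\ j0) \subset finset.setX I J.
  by apply: finset.setXS => //; apply: finset.subD1set.
apply: (@facet_of_criterion _ _ (i0, j0)) => //.
- exact: setX_arrows.
- by rewrite finset.in_setX iI.
- by rewrite finset.in_setX !inE eqxx andbF.
- apply: face_of_hull_setX => //.
  by apply: disjointWr IJ; apply: finset.subD1set.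
move=> c b [i j] tb; rewrite !finset.in_setX /= => /andP[iI' jJ'].
rewrite in_setD1 iI' jJ' /= andbT negbK => /eqP jj0; subst j0 => ab [k l].
rewrite finset.in_setX /= => /andP[kI lJ].
have [lj|lj] := eqVneq l j; last first.
  by apply: tb; rewrite finset.in_setX in_setD1 /= lj kI lJ.
subst l; case/orP: cond => [/set0Pn[j1]|/eqP I1]; last first.
  by move: kI iI'; rewrite I1 !inE => /eqP -> /eqP <-.
rewrite in_setD1 => /andP[j1j j1J].
have h k' : k' \in I -> dot c (vec (k', j1)) = b.
  by move=> kI'; apply: tb; rewrite finset.in_setX in_setD1 /= j1j j1J kI'.
by have := h _ kI; have := h _ iI'; move: ab; rewrite !dot_arrow_vec /=; lra.
Qed.

Lemma exists_facet_avoiding I J v s : [disjoint I & J]%B ->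
  v \in finset.setX I J -> s \subset finset.setX I J -> v \notin carrier s ->
  exists I' J', [/\ [disjoint I' & J']%B, s \subset finset.setX I' J',
    v \notin finset.setX I' J' &
    facet_of (hull vec (finset.setX I J)) (hull vec (finset.setX I' J'))].
Proof.
move=> IJ vIJ sIJ vs; have vI : v.1 \in I by case: v vIJ {vs} => i j;
  rewrite finset.in_setX => /andP[].
have vJ : v.2 \in J by case: v vIJ {vs vI} => i j;
  rewrite finset.in_setX => /andP[].
have IvJ : [disjoint I :\ v.1 & J]%B by apply: disjointWl IJ;
  apply: finset.subD1set.
have IJv : [disjoint I & J :\ v.2]%B by apply: disjointWr IJ;
  apply: finset.subD1set.
have vIv : v \notin finset.setX (I :\ v.1) J.
  by case: (v) => i j; rewrite finset.in_setX !inE eqxx.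
have vJv : v \notin finset.setX I (J :\ v.2).
  by case: (v) => i j; rewrite finset.in_setX !inE eqxx andbF.
have mem a : a \in s -> a.1 \in I /\ a.2 \in J.
  by move=> /(fintype.subsetP sIJ); case: (a) => ? ?;
    rewrite finset.in_setX => /andP.
have singl (H : {set 'I_n.+1}) x : x \in H -> H :\ x = finset.set0 -> H =
  [set x]%SET.
  by move=> xH e; rewrite -(finset.setD1K xH) e finset.setU0.
have [vt|vt] := boolP (v.1 \in [set a.1 | a in s]%SET); last first.
  have sub : s \subset finset.setX (I :\ v.1) J.
    apply/fintype.subsetP => a aS; have [aI aJ] := mem _ aS.
    have : a.1 != v.1 by apply: contraNneq vt => <-; apply: imset_f.
    by case: (a) aI aJ => i j /= aI aJ ne;
      rewrite finset.in_setX in_setD1 ne aI aJ.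
  have [c|] := boolP ((I :\ v.1 != finset.set0) || (J == [set v.2]%SET)).
    by exists (I :\ v.1), J; split=> //; apply: facet_remove_tail.
  rewrite negb_or negbK => /andP[/eqP I0 _].
  exists I, (J :\ v.2); split=> //; last first.
    by apply: facet_remove_head => //; rewrite -(singl _ _ vI I0) eqxx orbT.
  apply/fintype.subsetP => a /(fintype.subsetP sub).
  by rewrite I0; case: (a) => ? ?; rewrite finset.in_setX inE.
have vh : v.2 \notin [set a.2 | a in s]%SET.
  by apply: contra vs => vh; rewrite (surjective_pairing v) finset.in_setX vt.
have sub : s \subset finset.setX I (J :\ v.2).
  apply/fintype.subsetP => a aS; have [aI aJ] := mem _ aS.
  have : a.2 != v.2 by apply: contraNneq vh => <-; apply: imset_f.
  by case: (a) aI aJ => i j /= aI aJ ne;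
    rewrite finset.in_setX in_setD1 ne aI aJ.
have [c|] := boolP ((J :\ v.2 != finset.set0) || (I == [set v.1]%SET)).
  by exists I, (J :\ v.2); split=> //; apply: facet_remove_head.
rewrite negb_or negbK => /andP[/eqP J0 _].
exists (I :\ v.1), J; split=> //; last first.
  by apply: facet_remove_tail => //; rewrite -(singl _ _ vJ J0) eqxx orbT.
apply/fintype.subsetP => a /(fintype.subsetP sub).
by rewrite J0; case: (a) => ? ?; rewrite finset.in_setX inE andbF.
Qed.

(** The block is chosen to maximize [#|I| + #|J|]. The arrow [v] keeps the products nonempty, so
    that inclusion of blocks implies inclusion of both factors. *)
Lemma exists_maximal_face X I0 J0 v : X \subset arrows n ->
  [disjoint I0 & J0]%B -> finset.setX I0 J0 \subset X ->
    v \in finset.setX I0 J0 ->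
  exists I J, [/\ [disjoint I & J]%B, finset.setX I J \subset X,
    finset.setX I0 J0 \subset finset.setX I J &
    maximal_face (faces X) (hull vec (finset.setX I J))].
Proof.
move=> XA IJ0 IJ0X vIJ0.
pose P (p : {set 'I_n.+1} * {set 'I_n.+1}) := [&& [disjoint p.1 & p.2]%B,
  finset.setX p.1 p.2 \subset X &
    finset.setX I0 J0 \subset finset.setX p.1 p.2].
have P0 : P (I0, J0) by rewrite /P /= IJ0 IJ0X fintype.subxx.
case: (arg_maxnP (fun p : {set 'I_n.+1} * {set 'I_n.+1} => #|p.1|
  + #|p.2|)%N P0) => -[I J] /and3P[/= IJ IJX sub] max.
exists I, J; split=> //; split; first by exists I, J.
move=> _ [I' [J' [IJ' IJX' ->]]] le.
have le' a : a \in finset.setX I J -> a \in finset.setX I' J'.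
  move=> aIJ; apply: (@arrow_vec_in_hull R); last exact/le/mem_hull.
  by apply/(fintype.subsetP XA)/(fintype.subsetP IJX).
have := fintype.subsetP sub _ vIJ0; case: v {vIJ0} => i j.
rewrite finset.in_setX => /andP[iI jJ].
have II' : I \subset I'.
  apply/fintype.subsetP => k kI; have := le' (k, j).
  by rewrite !finset.in_setX kI jJ => /(_ isT)/andP[].
have JJ' : J \subset J'.
  apply/fintype.subsetP => k kJ; have := le' (i, k).
  by rewrite !finset.in_setX kJ iI => /(_ isT)/andP[].
have /max /= : P (I', J').
  by rewrite /P /= IJ' IJX' (fintype.subset_trans sub) //;
    apply/fintype.subsetP.
have := subset_leq_card II'; have := subset_leq_card JJ' => cJ cI c.
have /eqP <- : I == I' by rewrite eqEcard II' -(leq_add2r #|J'|) (leq_trans c)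
  // leq_add2l.
have /eqP <- // : J == J' by rewrite eqEcard JJ' -(leq_add2l #|I'|) (leq_trans
  c) // leq_add2r.
Qed.

End Facets.

(** * The pulling triangulation *)

Section Pulling.
Variables (R : realType) (n : nat) (lt : 'rV[R]_n.+1 -> 'rV[R]_n.+1 -> Prop).
Hypothesis hlt : strict_linear_order_on (vertices (@legendre R n)) lt.
Local Notation vec := (@arrow_vec R n).
Implicit Types (a v : arrow n) (s t X : {set arrow n}).

(** The order [lt] is linear only on the vertices of the polytope, so the properties of [prec] are
    stated on [arrows n]. *)
Definition prec a b : bool := `[< lt (vec a) (vec b) >].

Local Notation K := (compatible_sets prec).

Lemma prec_irr : {in arrows n, forall a, ~~ prec a a}.
Proof.
have [irr _ _] := hlt => a aA; apply/asboolPn.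
exact/irr/vertices_legendre.
Qed.

Lemma prec_trans : {in arrows n & &, transitive prec}.
Proof.
have [_ tr _] := hlt => b a c bA aA cA /asboolP ab /asboolP bc; apply/asboolP.
by apply: tr ab bc; apply: vertices_legendre.
Qed.

Lemma prec_total : {in arrows n &, forall a b, a != b -> prec a b || prec b a}.
Proof.
have [_ _ tot] := hlt => a b aA bA ab; apply/orP.
have ne : vec a <> vec b by move/(arrow_vec_inj aA bA)/eqP; apply/negP.
case: (tot _ _ (vertices_legendre R aA) (vertices_legendre R bA) ne) => h;
  by [left; apply/asboolP|right; apply/asboolP].
Qed.

Lemma least_vertex_faces X x : X \subset arrows n ->
  least_vertex lt (faces X) x ->
  exists v, [/\ v \in X, x = vec v & forall a, a \in X -> a != v -> prec v a].
Proof.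
move=> XA [/(complex_vertices_faces _ XA)[v vX ->] min]; exists v;
  split=> // a aX av.
apply/asboolP/min; first by apply/(complex_vertices_faces _ XA); exists a.
have [aA vA] := (fintype.subsetP XA _ aX, fintype.subsetP XA _ vX).
by move/(arrow_vec_inj aA vA)/eqP; apply/negP.
Qed.

Lemma least_vertex_min X v : X \subset arrows n -> v \in X ->
  (forall a, a \in X -> a != v -> prec v a) ->
    least_vertex lt (faces X) (vec v).
Proof.
move=> XA vX min; split; first by apply/(complex_vertices_faces _ XA); exists v.
move=> _ /(complex_vertices_faces _ XA)[a aX ->] av; apply/asboolP/min => //.
by apply: contra_notN av => /eqP ->.
Qed.

Lemma faces_set0 X : faces X (set0 : set 'rV[R]_n.+1).
Proof.
exists finset.set0, finset.set0.
have e : finset.setX finset.set0 finset.set0 = finset.set0 :> {set arrow n}.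
  by apply/finset.setP => -[i j]; rewrite !inE.
by rewrite e hull_set0 finset.sub0set -finset.setI_eq0 finset.set0I.
Qed.

(** Induction on the derivation, for all [X] at once, since deletion and restriction change [X]. *)
Lemma pulling_faces_sub P G : pulling lt P G ->
  forall X, X \subset arrows n -> P = faces X ->
  exists s, [/\ s \in K, carrier s \subset X & G = hull vec s].
Proof.
elim=> {P G} [P G base PG|P x G _ lv _ IH|P x M F G _ lv max Mx fac _ _ IH]
  X XA PE.
- have := PG; rewrite PE => -[I [J [IJ sub GE]]].
  have [s0|[a aIJ]] := set_0Vmem (finset.setX I J).
    exists finset.set0; rewrite compatible_set0; split=> //;
      last by rewrite GE s0.
    by apply/fintype.subsetP => a /carrierP[b [c []]]; rewrite inE.
  have aX := fintype.subsetP sub _ aIJ.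
  have aA := fintype.subsetP XA _ aX.
  have Ga : G (vec a) by rewrite GE; apply: mem_hull.
  exists [set a]%SET; rewrite (compatible_set1 prec_irr) //; split=> //.
    apply/fintype.subsetP => _ /carrierP[b [c [/set1P -> /set1P -> ->]]].
    by rewrite -surjective_pairing.
  rewrite hull_set1.
  case: base PG => [->|[v ->]] /=.
    by move=> G0; move: Ga; rewrite G0.
  by case=> G0; move: Ga; rewrite G0 // => ->.
- subst P; have [v [vX xE _]] := least_vertex_faces XA lv; subst x.
  have [|s [sK sX ->]] := IH (X :\ v) _ (deletion_faces _ _ (fintype.subsetP XA
    _ vX)).
    exact: fintype.subset_trans (finset.subD1set _ _) XA.
  by exists s; split=> //; apply: fintype.subset_trans sX (finset.subD1set _ _).
- subst P; have [v [vX xE vmin]] := least_vertex_faces XA lv; subst x.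
  have [[I [J [IJ IJX ME]]] _] := max.
  have [+ _ _] := fac; rewrite ME => /face_of_hullP[c [b [_ FE]]].
  set r := finset _ in FE.
  have rIJ : r \subset finset.setX I J by apply/fintype.subsetP => a;
    rewrite inE => /andP[].
  have vIJ : v \in finset.setX I J.
    by apply: (@arrow_vec_in_hull R); [apply: fintype.subsetP vX|rewrite -ME].
  have [||s [sK sX ->]] := IH (X :&: r)%SET.
  + exact: fintype.subset_trans (finset.subsetIl _ _) XA.
  + by rewrite FE restriction_faces.
  have sIJ : s \subset finset.setX I J.
    apply: fintype.subset_trans (subset_carrier s) _.
    by apply: fintype.subset_trans sX (fintype.subset_trans (finset.subsetIr _
      _) rIJ).
  (* The facet lies in the block of [M], so [s] and [v] share that block and [v] can be added to
     [s]. *)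
  exists (v |: s); rewrite conv_cone; split=> //.
    exact: (compatible_setU1 prec_irr prec_trans vmin IJ IJX XA vIJ sIJ sK).
  apply: fintype.subset_trans IJX; apply: carrier_subset.
  by rewrite finset.subUset finset.sub1set vIJ.
Qed.

(** Strong induction on the size of [X]. If the carrier of [s] misses the least arrow [v], the cell
    survives the deletion of [v]; otherwise it is a cone with apex [v]. *)
Lemma hull_in_pulling_faces X s : X \subset arrows n -> s \in K ->
  carrier s \subset X -> pulling lt (faces X) (hull vec s).
Proof.
have [m] := ubnP #|X|; elim: m X s => // m IH X s Xm XA sK sX.
have [emp|nemp] := pselect (empty_or_vertex (faces X : set (set 'rV[R]_n.+1))).
  apply: pulling_base => //.
  (* For nonempty [s] the hull of the carrier is a nonempty member of the complex, hence its single
     point, and [hull vec s] lies inside it. *)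
  have [->|[a aS]] := set_0Vmem s; first by rewrite hull_set0;
    apply: faces_set0.
  have sa := mem_hull vec aS; have sub := hull_subset (f :=
    vec) (subset_carrier s).
  have : faces X (hull vec (carrier s)).
    by exists [set a.1 | a in s]%SET, [set a.2 | a in s]%SET;
      rewrite (carrier_disjoint sK).
  have := sub _ sa; case: emp => [->|[v ->]] /= ca.
    by move=> c0; rewrite c0 in ca.
  case=> ce; first by rewrite ce in ca.
  right; apply/seteqP; split=> [x /sub|_ ->]; first by rewrite ce.
  by rewrite ce in ca; rewrite -ca.
have X0 : X != finset.set0.
  apply: contra_notN nemp => /eqP X0; left; apply/seteqP;
    split=> [_ [I [J [_ + ->]]]|_ ->].
    by rewrite X0 finset.subset0 => /eqP ->; apply: hull_set0.
  exact: faces_set0.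
have [v vX vmin] := exists_min prec_irr prec_trans prec_total XA X0.
have vA := fintype.subsetP XA _ vX; have lv := least_vertex_min XA vX vmin.
have [vs|vs] := boolP (v \in carrier s); last first.
  apply: (pulling_deletion nemp lv); rewrite deletion_faces //.
  apply: IH => //.
  - by move: Xm; rewrite (cardsD1 v) vX.
  - exact: fintype.subset_trans (finset.subD1set _ _) XA.
  - by rewrite finset.subsetD1 sX.
have vS := min_in_carrier vmin sK sX vs.
have s'K : s :\ v \in K by apply: compatible_subset sK; apply: finset.subD1set.
have s'X : carrier (s :\ v) \subset X.
  by apply: fintype.subset_trans sX; apply/carrierS/finset.subD1set.
have vs' : v \notin carrier (s :\ v).
  by apply/negP => /(min_in_carrier vmin s'K s'X); rewrite in_setD1 eqxx.
(* The maximal face is grown from the carrier of [s], so that it contains the whole cell and not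
   only [v]. *)
have [I [J [IJ IJX sIJ max]]] :=
  exists_maximal_face R XA (carrier_disjoint sK) sX vs.
have vIJ := fintype.subsetP sIJ _ vs.
have s'IJ : s :\ v \subset finset.setX I J.
  apply: fintype.subset_trans sIJ;
    apply: fintype.subset_trans (subset_carrier s).
  exact: finset.subD1set.
have [I' [J' [IJ' s'IJ' vIJ' fac]]] := exists_facet_avoiding R IJ vIJ s'IJ vs'.
rewrite -(finset.setD1K vS) -conv_cone.
apply: (pulling_cone nemp lv max _ fac); first exact: mem_hull.
  by move=> /(arrow_vec_in_hull vA); apply/negP.
rewrite restriction_faces //; apply: IH => //.
(* The arrow [v] lies in [X] but not in the block of the facet, so the size drops. *)
- move: Xm; rewrite ltnS; apply: leq_trans; apply: proper_card; apply/properP.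
  by split; [apply: finset.subsetIl|exists v => //;
    rewrite inE (negPf vIJ') andbF].
- exact: fintype.subset_trans (finset.subsetIl _ _) XA.
- by rewrite finset.subsetI s'X carrier_subset.
Qed.

Lemma pulling_boundary_legendre : (0 < n)%N ->
  pulling lt (boundary_complex (@legendre R n)) = [set hull vec s |
    s in [set` K]].
Proof.
move=> n0; rewrite boundary_legendre //; apply/seteqP; split=> [G|_ [s sK <-]].
  move=> /pulling_faces_sub GP; have [||s [sK _ ->]] := GP (arrows n) => //.
  by exists s.
by apply: hull_in_pulling_faces => //; apply: (carrier_arrows (sK : s \in K)).
Qed.

(** Compatibility is a condition on pairs, so a nonface contains an incompatible pair; were this
    pair a proper subset, minimality would make it a face. *)
Lemma flag_compatible_sets : flag [set vec @` [set` s] | s in [set` K]].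
Proof.
move=> S [Sv SK Smin].
have Sarrow x : S x -> exists2 a, a \in arrows n & vec a = x.
  move=> /Sv[s sK e]; have : [set x] x by []; rewrite -e => -[a aS <-].
  by exists a => //; apply: fintype.subsetP aS; apply: compatible_arrows sK.
pose s := [set a in arrows n | `[< S (vec a) >]]%SET.
have SE : S = vec @` [set` s].
  apply/seteqP; split=> [x Sx|_ [a /= + <-]].
    by have [a aA ax] := Sarrow _ Sx; exists a => //=; rewrite inE aA /= ax;
      apply/asboolP.
  by rewrite inE => /andP[_ /asboolP].
have /existsP[a /existsP[b /and3P[aS bS ab]]] :
    [exists a, exists b, [&& a \in s, b \in s & ~~ compat prec a b]].
  apply: contra_notT SK => none; exists s => //=;
    apply/compatible_setsP => a b aS bS.
  by apply: contraNT none => ab; apply/existsP; exists a; apply/existsP;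
    exists b; rewrite aS bS.
have [aA bA] : a \in arrows n /\ b \in arrows n by move: aS bS;
  rewrite !inE => /andP[-> _] /andP[].
exists (vec a), (vec b); split.
  move=> /(arrow_vec_inj aA bA) e; subst b; case/negP: ab.
  by have /compatible_setsP := compatible_set1 prec_irr aA; apply; rewrite inE.
have sub : [set vec a; vec b] `<=` S by move=> x [->|->]; rewrite SE;
  [exists a|exists b].
apply/seteqP; split=> //; apply: contrapT => nsub.
have [t tK te] := Smin _ (conj sub nsub).
have mem c : c \in arrows n -> [set vec a; vec b] (vec c) -> c \in t.
  move=> cA; rewrite -te => -[c' c't /arrow_vec_inj <- //].
  by apply: fintype.subsetP c't; apply: compatible_arrows tK.
have [at_ bt] : a \in t /\ b \in t by split; apply: mem => //; [left|right].
by case/negP: ab; move/compatible_setsP: tK; apply.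
Qed.

End Pulling.

Theorem theorem3p1 (R : realType) (n : nat) (hn : (1 <= n)%N)
    (lt : 'rV[R]_n.+1 -> 'rV[R]_n.+1 -> Prop)
    (hlt : strict_linear_order_on (vertices (@legendre R n)) lt) :
  flag_simplicial_complex (pulling lt (boundary_complex (@legendre R n))).
Proof.
have uniq := @representation_unique R n _ (prec_irr hlt) (prec_trans hlt)
  (prec_total hlt).
rewrite pulling_boundary_legendre //; split.
  apply: (hull_simplicial_complex (compatible_set0 _) _ uniq) => s t.
  exact: compatible_subset.
(* The vertices of a cell are exactly the vectors of its arrows, so the vertex scheme is the complex
   of compatible sets. *)
suff -> : vertex_scheme [set hull (@arrow_vec R n) s |
  s in [set` compatible_sets (prec lt)]] =
    [set (@arrow_vec R n) @` [set` s] | s in [set` compatible_sets (prec lt)]].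
  exact: flag_compatible_sets.
apply/seteqP; split=> [_ [_ [s sK <-] <-]|_ [s sK <-]].
  by exists s => //; rewrite (vertices_hull uniq).
by exists (hull (@arrow_vec R n) s); [exists s|rewrite (vertices_hull uniq)].
Qed.
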